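(* Let $K$ be a commutative semiring, $A$ a finite alphabet, and let $\sigma\in K\langle\langle A\rangle\rangle$ be a context-free power series. Then there exists a closed $\mu$-expression $t\in\mathcal{T}_\mu$ over $K$ such that $[\![t]\!]=\sigma$.
   Context: $K\langle\langle A\rangle\rangle$ is the set of functions $A^*\to K$, the final $K\times(-)^A$-coalgebra with $o(\sigma)=\sigma(\epsilon)$ and $\sigma_a(w)=\sigma(aw)$. For a finite set $X$, $K\langle X\rangle$ denotes the semiring of finitely supported functions $X^*\to K$ (noncommutative polynomials) with usual sum and product. Given $(o,\delta):X\to K\times K\langle X\rangle^A$ (write $x_a=\delta(x)(a)$), its extension to a $K\times(-)^A$-coalgebra on $K\langle X\rangle$ is: $\hat o(1)=1$, $1_a=0$; for $x\in X$, $w\in X^*$: $\hat o(xw)=o(x)\hat o(w)$, $(xw)_a=x_aw+o(x)w_a$; and linearly $\hat o(\sum k_iw_i)=\sum k_i\hat o(w_i)$, $(\sum k_iw_i)_a=\sum k_i(w_i)_a$. A power series is context-free (constructively algebraic) if it equals $[\![p]\!]$ for some finite $X$, some such $(o,\delta)$ and some $p\in K\langle X\rangle$, where $[\![-]\!]$ is the final homomorphism from the extension. $\mu$-expressions over a countably infinite variable set $V$: $t::=\bar k\ (k\in K)\mid x\ (x\in V)\mid \bar a\ (a\in A)\mid t+t\mid t\times t\mid \mu x.g$, with guarded terms $g::=\bar a\times t\ (a\in A)\mid \bar k\ (k\in K)\mid g+g$ ($\mu x$ binds $x$). $\mathcal{T}_\mu$ is the set of closed $\mu$-expressions, a $K\times(-)^A$-coalgebra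 via: $o(\bar k)=k$, $\bar k_a=\bar 0$; $o(\bar b)=0$, $\bar b_a=\bar 1$ if $b=a$ else $\bar 0$; $o(u+v)=o(u)+o(v)$, $(u+v)_a=u_a+v_a$; $o(u\times v)=o(u)\cdot o(v)$, $(u\times v)_a=(u_a\times v)+(\overline{o(u)}\times v_a)$; $o(\mu x.u)=o(u[\mu x.u/x])$, $(\mu x.u)_a=(u[\mu x.u/x])_a$, where $u[\mu x.u/x]$ substitutes $\mu x.u$ for the free occurrences of $x$. $[\![-]\!]:\mathcal{T}_\mu\to K\langle\langle A\rangle\rangle$ is the final homomorphism.
   Formalization: The derivative of a product with a letter on the left is taken as (b×v)_a = b_a×v, dropping the null summand 0×v_a, since the literal clause has no finite solution for μx.(b×x); the semantics still satisfies the original product rule. *)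

(* Defs.v *)
From HB Require Import structures.
From mathcomp Require Import all_boot all_algebra.
From mathcomp Require Import finmap.

Set Implicit Arguments.
Unset Strict Implicit.
Unset Printing Implicit Defensive.

Import GRing.Theory.
Local Open Scope ring_scope.

(** * Coalgebras for the functor [K * (-)^A] and the final one *)

Record coalgebra (K A : Type) := Coalgebra {
  carrier :> Type;
  out : carrier -> K;
  der : carrier -> A -> carrier
}.
Arguments Coalgebra {K A carrier}.
Arguments out {K A} c x.
Arguments der {K A} c x a.

Definition is_hom (K A : Type) (C D : coalgebra K A) (f : C -> D) : Prop :=
  (forall x : C, out D (f x) = out C x) /\
  (forall (x : C) (a : A), f (der C x a) = der D (f x) a).

Definition series (K A : Type) : Type := seq A -> K.

Definition series_coalgebra (K A : Type) : coalgebra K A :=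
  @Coalgebra K A (series K A)
    (fun sigma => sigma [::]) (fun sigma a w => sigma (a :: w)).

Definition final (K A : Type) (C : coalgebra K A) (x : C) : series K A :=
  fun w => out C (foldl (der C) x w).

Lemma final_hom (K A : Type) (C : coalgebra K A) :
  is_hom (D := series_coalgebra K A) (@final K A C).
Proof. by []. Qed.

Lemma final_unique (K A : Type) (C : coalgebra K A)
    (f : C -> series_coalgebra K A) :
  is_hom f -> forall x, f x =1 final x.
Proof.
case=> fo fd x w; elim: w x => [|a w IHw] x; first exact: fo.
by rewrite -[LHS]/(der (series_coalgebra K A) (f x) a w) -fd IHw.
Qed.

(** * The semiring of noncommutative polynomials [K<X>] *)

Definition ncpoly (K : pzSemiRingType) (X : choiceType) : Type :=
  {fsfun seq X -> K with 0}.

HB.instance Definition _ (K : pzSemiRingType) (X : choiceType) :=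
  Choice.on (ncpoly K X).

Section NcPolyModule.
Variables (K : pzSemiRingType) (X : choiceType).
Implicit Types (p q r : ncpoly K X) (k l : K) (u v w : seq X).

Definition nccoef p w : K := (p : {fsfun seq X -> K with 0}) w.

Definition ncsupp p : {fset seq X} := finsupp (p : {fsfun seq X -> K with 0}).

Definition ncmonom k u : ncpoly K X := [fsfun w in [fset u]%fset => k | 0].

Definition nczero : ncpoly K X := [fsfun].

Definition ncadd p q : ncpoly K X :=
  [fsfun w in (ncsupp p `|` ncsupp q)%fset => nccoef p w + nccoef q w | 0].

Definition ncscale k p : ncpoly K X :=
  [fsfun w in ncsupp p => k * nccoef p w | 0].

Lemma ncpolyP p q : nccoef p =1 nccoef q <-> p = q.
Proof. exact: fsfunP. Qed.

Lemma nccoef_out p w : w \notin ncsupp p -> nccoef p w = 0.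
Proof. exact: fsfun_dflt. Qed.

Lemma nccoef_monom k u w : nccoef (ncmonom k u) w = if w == u then k else 0.
Proof. by rewrite /nccoef fsfunE inE. Qed.

Lemma nccoef_zero w : nccoef nczero w = 0.
Proof. by rewrite /nccoef fsfunE. Qed.

Lemma nccoef_add p q w : nccoef (ncadd p q) w = nccoef p w + nccoef q w.
Proof.
rewrite {1}/nccoef fsfunE inE; case: ifPn => // /norP[pw qw].
by rewrite !nccoef_out ?addr0.
Qed.

Lemma nccoef_scale k p w : nccoef (ncscale k p) w = k * nccoef p w.
Proof.
rewrite {1}/nccoef fsfunE; case: ifPn => // pw.
by rewrite nccoef_out ?mulr0.
Qed.

Lemma ncaddA : associative ncadd.
Proof. by move=> p q r; apply/ncpolyP => w; rewrite !nccoef_add addrA. Qed.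

Lemma ncaddC : commutative ncadd.
Proof. by move=> p q; apply/ncpolyP => w; rewrite !nccoef_add addrC. Qed.

Lemma ncadd0 : left_id nczero ncadd.
Proof. by move=> p; apply/ncpolyP => w; rewrite nccoef_add nccoef_zero add0r. Qed.

HB.instance Definition _ :=
  GRing.isNmodule.Build (ncpoly K X) ncaddA ncaddC ncadd0.

Lemma nccoef0 w : nccoef 0 w = 0.
Proof. exact: nccoef_zero. Qed.

Lemma nccoefD p q w : nccoef (p + q) w = nccoef p w + nccoef q w.
Proof. exact: nccoef_add. Qed.

Lemma ncscaleA k l p : ncscale k (ncscale l p) = ncscale (k * l) p.
Proof. by apply/ncpolyP => w; rewrite !nccoef_scale mulrA. Qed.

Lemma ncscale0 p : ncscale 0 p = 0.
Proof. by apply/ncpolyP => w; rewrite nccoef_scale nccoef0 mul0r. Qed.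

Lemma ncscale1 : left_id 1 ncscale.
Proof. by move=> p; apply/ncpolyP => w; rewrite nccoef_scale mul1r. Qed.

Lemma ncscaleDr : right_distributive ncscale +%R.
Proof.
by move=> k p q; apply/ncpolyP => w; rewrite !(nccoef_scale, nccoefD) mulrDr.
Qed.

Lemma ncscaleDl p : {morph ncscale^~ p : k l / k + l}.
Proof.
by move=> k l; apply/ncpolyP => w; rewrite !(nccoef_scale, nccoefD) mulrDl.
Qed.

HB.instance Definition _ :=
  GRing.Nmodule_isLSemiModule.Build K (ncpoly K X)
    ncscaleA ncscale0 ncscale1 ncscaleDr ncscaleDl.

Lemma nccoefZ k p w : nccoef (k *: p) w = k * nccoef p w.
Proof. exact: nccoef_scale. Qed.

Lemma nccoef_sum (I : Type) (s : seq I) (F : I -> ncpoly K X) w :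
  nccoef (\sum_(i <- s) F i) w = \sum_(i <- s) nccoef (F i) w.
Proof. exact: (big_morph (nccoef^~ w) (fun p q => nccoefD p q w) (nccoef0 w)). Qed.

Lemma ncpolyE p : p = \sum_(w <- ncsupp p) ncmonom (nccoef p w) w.
Proof.
apply/ncpolyP => w; rewrite nccoef_sum.
have [pw|pw] := boolP (w \in ncsupp p); last first.
  rewrite nccoef_out // big_seq big1 // => u pu; rewrite nccoef_monom.
  by case: eqP => // wu; rewrite wu pu in pw.
rewrite (big_fsetD1 w) //= nccoef_monom eqxx big_seq big1 ?addr0 // => u.
by rewrite !inE nccoef_monom eq_sym => /andP[/negPf ->].
Qed.

(** Linear extension to [K<X>] of a map given on words. *)
Definition lin_ext (V : lSemiModType K) (F : seq X -> V) p : V :=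
  \sum_(w <- ncsupp p) nccoef p w *: F w.

Section LinExt.
Variables (V : lSemiModType K) (F : seq X -> V).

Lemma lin_ext_widen (D : {fset seq X}) p : (ncsupp p `<=` D)%fset ->
  lin_ext F p = \sum_(w <- D) nccoef p w *: F w.
Proof.
move=> sD; apply/big_fset_incl => // w _ pw.
by rewrite nccoef_out ?scale0r.
Qed.

Lemma lin_ext0 : lin_ext F 0 = 0.
Proof. by rewrite /lin_ext big1 // => w _; rewrite nccoef0 scale0r. Qed.

Lemma lin_extD p q : lin_ext F (p + q) = lin_ext F p + lin_ext F q.
Proof.
set D := (ncsupp p `|` ncsupp q `|` ncsupp (p + q)%R)%fset.
rewrite !(@lin_ext_widen D); first last.
- exact: fsubsetUr.
- by rewrite /D -fsetUA fsubsetUl.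
- by rewrite /D fsetUAC fsubsetUr.
by rewrite -big_split; apply: eq_bigr => w _; rewrite nccoefD scalerDl.
Qed.

Lemma lin_extZ k p : lin_ext F (k *: p) = k *: lin_ext F p.
Proof.
set D := (ncsupp p `|` ncsupp (k *: p)%R)%fset.
rewrite !(@lin_ext_widen D) ?fsubsetUl ?fsubsetUr // scaler_sumr.
by apply: eq_bigr => w _; rewrite nccoefZ scalerA.
Qed.

Lemma lin_ext_monom k u : lin_ext F (ncmonom k u) = k *: F u.
Proof.
rewrite (@lin_ext_widen [fset u]%fset); last first.
  apply/fsubsetP => w; apply: contraLR => wu; apply/negP => pw.
  move: pw; rewrite mem_finsupp -/(nccoef _ _) nccoef_monom.
  by move: wu; rewrite inE => /negPf ->; rewrite eqxx.
by rewrite big_seq_fset1 nccoef_monom eqxx.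
Qed.

Lemma lin_ext_sum (I : Type) (s : seq I) (f : I -> ncpoly K X) :
  lin_ext F (\sum_(i <- s) f i) = \sum_(i <- s) lin_ext F (f i).
Proof. exact: (big_morph (lin_ext F) lin_extD lin_ext0). Qed.

End LinExt.

Lemma eq_lin_ext (V : lSemiModType K) (F G : seq X -> V) :
  F =1 G -> lin_ext F =1 lin_ext G.
Proof. by move=> FG p; apply: eq_bigr => w _; rewrite FG. Qed.

End NcPolyModule.

Section NcPolySemiRing.
Variables (K : comPzSemiRingType) (X : choiceType).
Implicit Types (p q r : ncpoly K X) (k l : K) (u v w : seq X).

Definition ncone : ncpoly K X := ncmonom 1 [::].

Definition ncmul p q : ncpoly K X :=
  \sum_(u <- ncsupp p) \sum_(v <- ncsupp q)
     ncmonom (nccoef p u * nccoef q v) (u ++ v).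

Lemma ncmonomZ k l u : k *: ncmonom l u = ncmonom (k * l) u :> ncpoly K X.
Proof.
apply/ncpolyP => w; rewrite nccoefZ !nccoef_monom.
by case: eqP; rewrite ?mulr0.
Qed.

Lemma ncmulE p q :
  ncmul p q = lin_ext (fun u => lin_ext (fun v => ncmonom 1 (u ++ v)) q) p.
Proof.
apply: eq_bigr => u _; rewrite scaler_sumr; apply: eq_bigr => v _.
by rewrite scalerA ncmonomZ mulr1.
Qed.

Lemma ncmul0p : left_zero 0 ncmul.
Proof. by move=> p; rewrite ncmulE lin_ext0. Qed.

Lemma ncmulp0 : right_zero 0 ncmul.
Proof.
move=> p; rewrite ncmulE /lin_ext big1 // => u _.
by rewrite [X in _ *: X]lin_ext0 scaler0.
Qed.

Lemma ncmulDl : left_distributive ncmul +%R.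
Proof. by move=> p q r; rewrite !ncmulE lin_extD. Qed.

Lemma ncmulDr : right_distributive ncmul +%R.
Proof.
move=> p q r; rewrite !ncmulE.
rewrite [LHS]/lin_ext [X in _ = X + _]/lin_ext [X in _ = _ + X]/lin_ext.
rewrite -big_split /=; apply: eq_bigr => u _.
by rewrite -scalerDr -lin_extD.
Qed.

Lemma ncmul_monom k l u v :
  ncmul (ncmonom k u) (ncmonom l v) = ncmonom (k * l) (u ++ v).
Proof. by rewrite ncmulE !lin_ext_monom scalerA ncmonomZ mulr1. Qed.

Lemma ncmul_suml (I : Type) (s : seq I) (F : I -> ncpoly K X) q :
  ncmul (\sum_(i <- s) F i) q = \sum_(i <- s) ncmul (F i) q.
Proof. exact: (big_morph (ncmul^~ q) (fun p r => ncmulDl p r q) (ncmul0p q)). Qed.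

Lemma ncmul_sumr (I : Type) (s : seq I) (F : I -> ncpoly K X) p :
  ncmul p (\sum_(i <- s) F i) = \sum_(i <- s) ncmul p (F i).
Proof. exact: (big_morph (ncmul p) (ncmulDr p) (ncmulp0 p)). Qed.

Lemma ncmulA : associative ncmul.
Proof.
move=> p q r; rewrite (ncpolyE p) !ncmul_suml; apply: eq_bigr => u _.
rewrite (ncpolyE q) ncmul_suml !ncmul_sumr ncmul_suml; apply: eq_bigr => v _.
rewrite (ncpolyE r) !ncmul_sumr; apply: eq_bigr => w _.
by rewrite !ncmul_monom mulrA catA.
Qed.

Lemma ncmul1p : left_id ncone ncmul.
Proof.
move=> p; rewrite {1}(ncpolyE p) ncmul_sumr [RHS]ncpolyE.
by apply: eq_bigr => w _; rewrite ncmul_monom mul1r.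
Qed.

Lemma ncmulp1 : right_id ncone ncmul.
Proof.
move=> p; rewrite {1}(ncpolyE p) ncmul_suml [RHS]ncpolyE.
by apply: eq_bigr => w _; rewrite ncmul_monom mulr1 cats0.
Qed.

HB.instance Definition _ :=
  GRing.Nmodule_isPzSemiRing.Build (ncpoly K X)
    ncmulA ncmul1p ncmulp1 ncmulDl ncmulDr ncmul0p ncmulp0.

End NcPolySemiRing.

(** * Context-free power series *)

Section PolyCoalgebra.
Variables (K : comPzSemiRingType) (A : Type) (X : choiceType).
Variables (o : X -> K) (delta : X -> A -> ncpoly K X).

Fixpoint word_out (w : seq X) : K :=
  if w is x :: v then o x * word_out v else 1.

Fixpoint word_der (w : seq X) (a : A) : ncpoly K X :=
  if w is x :: v
  then delta x a * ncmonom 1 v + o x *: word_der v a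
  else 0.

Definition poly_out (p : ncpoly K X) : K :=
  \sum_(w <- ncsupp p) nccoef p w * word_out w.

Definition poly_der (p : ncpoly K X) (a : A) : ncpoly K X :=
  \sum_(w <- ncsupp p) nccoef p w *: word_der w a.

Definition poly_coalgebra : coalgebra K A := Coalgebra poly_out poly_der.

End PolyCoalgebra.

Definition context_free (K : comPzSemiRingType) (A : finType)
    (sigma : series K A) : Prop :=
  exists (X : finType) (o : X -> K) (delta : X -> A -> ncpoly K X)
         (p : poly_coalgebra o delta),
    final p =1 sigma.

(** * mu-expressions, with variables in [nat] *)

Inductive mexp (K A : Type) : Type :=
| MConst of K
| MVar of nat
| MChar of A
| MAdd of mexp K A & mexp K A
| MMul of mexp K A & mexp K A
| MMu of nat & gexp K A
with gexp (K A : Type) : Type :=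
| GMul of A & mexp K A
| GConst of K
| GAdd of gexp K A & gexp K A.

Arguments MVar {K A} _.
Arguments MConst {K A} _.
Arguments MChar {K A} _.
Arguments GConst {K A} _.

Fixpoint mexp_of_gexp (K A : Type) (g : gexp K A) : mexp K A :=
  match g with
  | GMul a t => MMul (MChar a) t
  | GConst k => MConst k
  | GAdd g h => MAdd (mexp_of_gexp g) (mexp_of_gexp h)
  end.
Coercion mexp_of_gexp : gexp >-> mexp.

Scheme mexp_gexp_ind := Induction for mexp Sort Prop
  with gexp_mexp_ind := Induction for gexp Sort Prop.
Combined Scheme mexp_gexp_mutind from mexp_gexp_ind, gexp_mexp_ind.

Section Substitution.
Variables (K A : Type).
Implicit Types (r t : mexp K A) (g : gexp K A) (x : nat).

Fixpoint fv t : seq nat :=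
  match t with
  | MConst _ | MChar _ => [::]
  | MVar x => [:: x]
  | MAdd u v | MMul u v => fv u ++ fv v
  | MMu x g => [seq y <- gfv g | y != x]
  end
with gfv g : seq nat :=
  match g with
  | GMul _ t => fv t
  | GConst _ => [::]
  | GAdd g h => gfv g ++ gfv h
  end.

Definition closed t : bool := fv t == [::].

(** Substitution for the free occurrences of [x].  Bound variables are not
    renamed, so this is meant for closed [r] only, where no capture occurs. *)
Fixpoint subst x r t : mexp K A :=
  match t with
  | MConst k => MConst k
  | MVar y => if y == x then r else MVar y
  | MChar a => MChar a
  | MAdd u v => MAdd (subst x r u) (subst x r v)
  | MMul u v => MMul (subst x r u) (subst x r v)
  | MMu y g => MMu y (if y == x then g else gsubst x r g)
  end
with gsubst x r g : gexp K A :=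
  match g with
  | GMul a t => GMul a (subst x r t)
  | GConst k => GConst k
  | GAdd g h => GAdd (gsubst x r g) (gsubst x r h)
  end.

Lemma gexp_subst x r g : gsubst x r g = subst x r g :> mexp K A.
Proof. by elim: g => //= g -> h ->. Qed.

Lemma gexp_fv g : fv g = gfv g.
Proof. by elim: g => //= g -> h ->. Qed.

Lemma fv_subst x r : closed r ->
  (forall t, fv (subst x r t) = [seq y <- fv t | y != x]) /\
  (forall g, gfv (gsubst x r g) = [seq y <- gfv g | y != x]).
Proof.
move=> /eqP r0; apply: mexp_gexp_mutind => //=.
- by move=> y; case: eqP => //=.
- by move=> u -> v ->; rewrite filter_cat.
- by move=> u -> v ->; rewrite filter_cat.
- move=> y g IHg; case: eqP => [->|_].
    by rewrite -filter_predI; apply: eq_filter => z /=; rewrite andbb.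
  by rewrite IHg -!filter_predI; apply: eq_filter => z /=; rewrite andbC.
- by move=> g -> h ->; rewrite filter_cat.
Qed.

End Substitution.

Section MuCoalgebra.
Variables (K : comPzSemiRingType) (A : eqType).
Implicit Types (t u v : mexp K A) (g h : gexp K A) (a b : A).

Definition char_der b a : mexp K A := MConst (if b == a then 1 else 0).

(** The output and derivatives of a guarded term [b * t] do not involve those
    of [t]: the output is [0 * out t = 0], and the summand [0 * t_a] of the
    derivative is dropped.  This is what makes the clauses for [mu] below
    well founded: for [t = mu x. b * x], no (finite) expression [t_a] solves
    the equation [t_a = (b_a * t) + (0 * t_a)] obtained otherwise (see
    [no_undropped_der]).  The dropped summand does not affect the semantics
    (see [mexp_semM]). *)
Fixpoint gout g : K :=
  match g with
  | GMul _ _ => 0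
  | GConst k => k
  | GAdd g h => gout g + gout h
  end.

Fixpoint gder g a : mexp K A :=
  match g with
  | GMul b t => MMul (char_der b a) t
  | GConst _ => MConst 0
  | GAdd g h => MAdd (gder g a) (gder h a)
  end.

(** The values on a free variable are irrelevant: see [mu_exp] below. *)
Fixpoint mout t : K :=
  match t with
  | MConst k => k
  | MVar _ => 0
  | MChar _ => 0
  | MAdd u v => mout u + mout v
  | MMul u v => mout u * mout v
  | MMu x g => gout (gsubst x t g)
  end.

Fixpoint mder t a : mexp K A :=
  match t with
  | MConst _ => MConst 0
  | MVar _ => MConst 0
  | MChar b => char_der b a
  | MAdd u v => MAdd (mder u a) (mder v a)
  | MMul (MChar b) v => MMul (char_der b a) v
  | MMul u v => MAdd (MMul (mder u a) v) (MMul (MConst (mout u)) (mder v a))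
  | MMu x g => gder (gsubst x t g) a
  end.

Lemma gexp_out g : mout g = gout g.
Proof. by elim: g => //= [b t|g -> h ->] //; rewrite mul0r. Qed.

Lemma gexp_der g a : mder g a = gder g a.
Proof. by elim: g => //= g -> h ->. Qed.

Lemma mout_mu x g : mout (MMu x g) = mout (subst x (MMu x g) g).
Proof. by rewrite -gexp_subst gexp_out. Qed.

Lemma mder_mu x g a : mder (MMu x g) a = mder (subst x (MMu x g) g) a.
Proof. by rewrite -gexp_subst gexp_der. Qed.

Lemma no_undropped_der (D : mexp K A -> A -> mexp K A) (b : A) :
  (forall u v a, D (MMul u v) a =
     MAdd (MMul (D u a) v) (MMul (MConst (mout u)) (D v a))) ->
  (forall x g a, D (MMu x g) a = D (subst x (MMu x g) g) a) ->
  False.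
Proof.
move=> DM Dmu; pose t : mexp K A := MMu 0 (GMul b (MVar 0)).
have : D t b = MAdd (MMul (D (MChar b) b) t) (MMul (MConst 0) (D t b)).
  by rewrite {1}Dmu /= DM.
pose fix size (s : mexp K A) : nat :=
  match s with MAdd u v | MMul u v => (size u + size v).+1 | _ => 0%N end.
move=> /(congr1 size) /= /eqP; apply/negP; rewrite neq_ltn; apply/orP; left.
by rewrite ltnS add0n -addSnnS leq_addl.
Qed.

Lemma closedD u v : closed (MAdd u v) = closed u && closed v.
Proof. by rewrite /closed /=; case: (fv u). Qed.

Lemma closedM u v : closed (MMul u v) = closed u && closed v.
Proof. by rewrite /closed /=; case: (fv u). Qed.

Lemma closed_gder g a : closed g -> closed (gder g a).
Proof.
elim: g => //= g IHg h IHh; rewrite !closedD => /andP[gc hc].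
by rewrite IHg ?IHh.
Qed.

Lemma closed_mder t a : closed t -> closed (mder t a).
Proof.
elim: t => // [u IHu v IHv|u IHu v IHv|x g].
- by rewrite !closedD => /andP[uc vc]; rewrite IHu ?IHv.
- rewrite closedM => /andP[uc vc].
  have D : closed (MAdd (MMul (mder u a) v) (MMul (MConst (mout u)) (mder v a))).
    by rewrite closedD !closedM IHu // IHv // vc.
  by case: u D {IHu uc} => //= b _; rewrite closedM vc.
- move=> tc; apply: closed_gder; rewrite /closed gexp_fv.
  by rewrite (proj2 (fv_subst x tc)).
Qed.

Record mu_exp : Type := MuExp { mexp_of :> mexp K A; mexp_closed : closed mexp_of }.

Definition mu_out (t : mu_exp) : K := mout t.

Definition mu_der (t : mu_exp) (a : A) : mu_exp :=
  MuExp (closed_mder a (mexp_closed t)).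

Definition mu_coalgebra : coalgebra K A := Coalgebra mu_out mu_der.

(** The clause [(u * v)_a = (u_a * v) + (out u * v_a)] holds for the semantics
    in all cases, including when [u] is a letter. *)
Definition mexp_sem t (w : seq A) : K := mout (foldl mder t w).

Lemma final_mu (t : mu_coalgebra) : final t =1 mexp_sem t.
Proof. by move=> w; elim: w t => [|a w IHw] t //; apply: (IHw (mu_der t a)). Qed.

Lemma mexp_semD u v w : mexp_sem (MAdd u v) w = mexp_sem u w + mexp_sem v w.
Proof.
elim: w u v => [|a w IHw] u v //.
by rewrite -[LHS]/(mexp_sem (MAdd (mder u a) (mder v a)) w) IHw.
Qed.

Lemma mexp_sem0M v w : mexp_sem (MMul (MConst 0) v) w = 0.
Proof.
elim: w v => [|a w IHw] v; first by rewrite /mexp_sem /= mul0r.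
rewrite -[LHS]/(mexp_sem (MAdd (MMul (MConst 0) v) (MMul (MConst 0) (mder v a))) w).
by rewrite mexp_semD !IHw addr0.
Qed.

Lemma mexp_semM u v a w :
  mexp_sem (MMul u v) (a :: w) =
  mexp_sem (MAdd (MMul (mder u a) v) (MMul (MConst (mout u)) (mder v a))) w.
Proof. by case: u => // b; rewrite mexp_semD mexp_sem0M addr0. Qed.

End MuCoalgebra.

(* Main.v *)
(** For a letter [x] of the system and the set [S] of letters already bound,
    let [E_S(x)] be the variable [x] when [x] is in [S], and otherwise
    [mu x. (o(x) + sum_a a * x_a)] with every letter [y] occurring in [x_a]
    replaced by [E_(S + x)(y)]; as [S] grows, this nesting has depth at most
    [#|X|].  If the free variables [y] of [E_S(x)] are replaced by closed
    expressions that agree with [[y]] on words of length less than [n], the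
    result agrees with [[x]] on words of length less than [n]: after unfolding
    the outer [mu], guardedness reduces level [n + 1] for [S] to level [n] for
    [S + x].  For empty [S] no assumption on variables is left. *)

From mathcomp Require Import finmap.
From mathcomp Require Import all_boot all_algebra.
Require Import Defs.

Set Implicit Arguments.
Unset Strict Implicit.
Unset Printing Implicit Defensive.

Import GRing.Theory.
Local Open Scope ring_scope.

(** * Cauchy product of power series, and agreement up to a given length *)

Section SeriesProduct.
Variables (K : pzSemiRingType) (A : Type).
Implicit Types (s t : series K A) (w : seq A).

(** The Cauchy product, given by the product rule [(s t)_a = s_a t + s(eps) t_a] rather than as a
    sum over factorizations of [w], so that it matches the derivative clauses of both coalgebras. *)
Fixpoint series_mul s t w : K :=
  if w is a :: w' then series_mul (fun v => s (a :: v)) t w' + s [::] * t w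
  else s [::] * t [::].

(** The strict bound makes [agree 0] vacuous: this is the base case in [agree_solution]. *)
Definition agree n s t := forall w, (size w < n)%N -> s w = t w.

(** The value of a product at [w] involves its factors only on words no longer than [w]. *)
Lemma series_mul_agree n s s' t t' :
  agree n s s' -> agree n t t' -> agree n (series_mul s t) (series_mul s' t').
Proof.
move=> ss' tt' w; elim: w n s s' ss' tt' => [|a w IHw] n s s' ss' tt' wn /=.
  by rewrite ss' ?tt'.
case: n => // n in ss' tt' wn *.
rewrite ss' // (tt' (a :: w)) //; congr (_ + _).
by apply: (IHw n) => // v vn; [exact: ss' | apply: tt'; exact: ltnW].
Qed.

End SeriesProduct.

(** * Semantics of polynomials: linearity and multiplicativity *)

Section PolySemantics.
Variables (K : comPzSemiRingType) (A : Type) (X : choiceType).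
Variables (o : X -> K) (delta : X -> A -> ncpoly K X).
Implicit Types (p q : poly_coalgebra o delta) (u v : seq X) (x : X).

Lemma poly_outD p q : poly_out o (p + q) = poly_out o p + poly_out o q.
(* [poly_out] is [lin_ext] with values in [K], seen as a semimodule over itself. *)
Proof. exact: (@lin_extD K X K^o). Qed.

Lemma poly_outZ k p : poly_out o (k *: p) = k * poly_out o p.
Proof. exact: (@lin_extZ K X K^o). Qed.

Lemma poly_out_monom k u : poly_out o (ncmonom k u) = k * word_out o u.
Proof. exact: (@lin_ext_monom K X K^o). Qed.

Lemma poly_out0 : poly_out o 0 = 0.
Proof. exact: (@lin_ext0 K X K^o). Qed.

Lemma poly_derD p q a :
  poly_der o delta (p + q) a = poly_der o delta p a + poly_der o delta q a.
Proof. exact: lin_extD. Qed.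

Lemma poly_derZ k p a :
  poly_der o delta (k *: p) a = k *: poly_der o delta p a.
Proof. exact: lin_extZ. Qed.

Lemma poly_der0 a : poly_der o delta 0 a = 0.
Proof. exact: lin_ext0. Qed.

Lemma poly_der_monom k u a :
  poly_der o delta (ncmonom k u) a = k *: word_der o delta u a.
Proof. exact: lin_ext_monom. Qed.

Lemma final_polyD p q w :
  final (p + q : poly_coalgebra o delta) w = final p w + final q w.
Proof.
elim: w p q => [|a w IHw] p q; first exact: poly_outD.
by rewrite -IHw -poly_derD.
Qed.

Lemma final_polyZ k p w :
  final (k *: p : poly_coalgebra o delta) w = k * final p w.
Proof.
elim: w p => [|a w IHw] p; first exact: poly_outZ.
by rewrite -IHw -poly_derZ.
Qed.

Lemma final_poly0 w : final (0 : poly_coalgebra o delta) w = 0.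
Proof.
elim: w => [|a w IHw]; first exact: poly_out0.
by rewrite -[RHS]IHw -[in RHS](poly_der0 a).
Qed.

Lemma ncpoly_ind (P : ncpoly K X -> Prop) :
  P 0 -> (forall p q, P p -> P q -> P (p + q)) ->
  (forall k u, P (ncmonom k u)) -> forall p, P p.
Proof. by move=> P0 PD PM p; rewrite (ncpolyE p); elim/big_ind: _. Qed.

Lemma nc1E : 1 = ncmonom 1 [::] :> ncpoly K X.
Proof. by []. Qed.

Lemma ncmonomM k l u v :
  ncmonom k u * ncmonom l v = ncmonom (k * l) (u ++ v) :> ncpoly K X.
Proof. exact: ncmul_monom. Qed.

Lemma ncscaleAl k (p q : ncpoly K X) : k *: (p * q) = (k *: p) * q.
Proof.
elim/ncpoly_ind: p => [|p p' IHp IHp'|l u].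
- by rewrite !(mul0r, scaler0).
- by rewrite mulrDl !scalerDr mulrDl IHp IHp'.
elim/ncpoly_ind: q => [|q q' IHq IHq'|m v].
- by rewrite !(mulr0, scaler0).
- by rewrite !mulrDr scalerDr IHq IHq'.
by rewrite ncmonomZ !ncmonomM ncmonomZ mulrA.
Qed.

Lemma word_out_cat u v : word_out o (u ++ v) = word_out o u * word_out o v.
Proof. by elim: u => [|x u IHu] /=; rewrite ?mul1r // IHu mulrA. Qed.

Lemma word_der_cat u v a :
  word_der o delta (u ++ v) a =
  word_der o delta u a * ncmonom 1 v + word_out o u *: word_der o delta v a.
Proof.
elim: u => [|x u IHu] /=; first by rewrite mul0r add0r scale1r.
rewrite IHu scalerDr mulrDl -mulrA ncmonomM mulr1 addrA scalerA.
by rewrite ncscaleAl.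
Qed.

Lemma poly_outM p v :
  poly_out o (p * ncmonom 1 v : ncpoly K X) = poly_out o p * word_out o v.
Proof.
elim/ncpoly_ind: p => [|p q IHp IHq|k u].
- by rewrite mul0r poly_out0 mul0r.
- by rewrite mulrDl !poly_outD IHp IHq mulrDl.
by rewrite ncmonomM mulr1 !poly_out_monom word_out_cat mulrA.
Qed.

Lemma poly_derM p v a :
  poly_der o delta (p * ncmonom 1 v : ncpoly K X) a =
  poly_der o delta p a * ncmonom 1 v + poly_out o p *: word_der o delta v a.
Proof.
elim/ncpoly_ind: p => [|p q IHp IHq|k u].
- by rewrite mul0r !poly_der0 poly_out0 mul0r scale0r addr0.
- by rewrite mulrDl !poly_derD poly_outD IHp IHq mulrDl scalerDl addrACA.
rewrite ncmonomM mulr1 !poly_der_monom poly_out_monom word_der_cat scalerDr.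
by rewrite scalerA ncscaleAl.
Qed.

Definition final_word u : series K A :=
  final (ncmonom 1 u : poly_coalgebra o delta).

(** By [poly_derM], the derivatives of the left side obey the recursion that defines [series_mul]. A
    right factor [ncmonom 1 v] is the shape occurring in [word_der], and it stays fixed in the first
    summand. *)
Lemma final_polyM p v :
  final (p * ncmonom 1 v : poly_coalgebra o delta) =1
  series_mul (final p) (final_word v).
Proof.
move=> w; elim: w p => [|a w IHw] p /=.
  rewrite -[LHS]/(poly_out o (p * ncmonom 1 v : ncpoly K X)) poly_outM.
  by rewrite -[final_word v _]/(poly_out o _) poly_out_monom mul1r.
rewrite -[LHS]/(final (poly_der o delta (p * ncmonom 1 v : ncpoly K X) a
                        : poly_coalgebra o delta) w).
rewrite poly_derM final_polyD IHw final_polyZ; congr (_ + _ * _).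
rewrite -[RHS]/(final (poly_der o delta (ncmonom 1 v) a
                        : poly_coalgebra o delta) w).
by rewrite poly_der_monom scale1r.
Qed.

Lemma final_word_nil w : final_word [::] w = if w is [::] then 1 else 0.
Proof.
case: w => [|a w]; first by rewrite -[LHS]/(poly_out o _) poly_out_monom mulr1.
rewrite -[LHS]/(final (poly_der o delta (ncmonom 1 [::]) a
                        : poly_coalgebra o delta) w).
by rewrite poly_der_monom scaler0 final_poly0.
Qed.

Lemma final_word_cons x v :
  final_word (x :: v) =1 series_mul (final_word [:: x]) (final_word v).
Proof. by move=> w; rewrite -final_polyM ncmonomM mulr1. Qed.

Lemma final_letter x w :
  final_word [:: x] w =
  if w is a :: w' then final (delta x a : poly_coalgebra o delta) w' else o x.
Proof.
case: w => [|a w].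
  by rewrite -[LHS]/(poly_out o _) poly_out_monom mul1r /= mulr1.
rewrite -[LHS]/(final (poly_der o delta (ncmonom 1 [:: x]) a
                        : poly_coalgebra o delta) w).
by rewrite poly_der_monom /= scale1r scaler0 addr0 -nc1E mulr1.
Qed.

Lemma final_polyE p w :
  final p w = \sum_(u <- ncsupp p) nccoef p u * final_word u w.
Proof.
rewrite {1}(ncpolyE p).
rewrite (big_morph (fun q : ncpoly K X => final (q : poly_coalgebra o delta) w)
  (fun q r => final_polyD q r w) (final_poly0 w)).
by apply: eq_bigr => u _; rewrite -final_polyZ ncmonomZ mulr1.
Qed.

End PolySemantics.

(** * Compositional semantics of mu-expressions *)

Section MuSemantics.
Variables (K : comPzSemiRingType) (A : eqType).
Implicit Types (t u v : mexp K A) (g : gexp K A) (a : A) (w : seq A).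

Lemma mexp_sem_cons t a w : mexp_sem t (a :: w) = mexp_sem (mder t a) w.
Proof. by []. Qed.

Lemma mexp_sem_const k w :
  mexp_sem (MConst k : mexp K A) w = if w is [::] then k else 0.
Proof.
case: w => // a w; rewrite mexp_sem_cons /=.
by elim: w => // b w IHw; rewrite mexp_sem_cons.
Qed.

Lemma mexp_sem_constM k t w :
  mexp_sem (MMul (MConst k) t) w = k * mexp_sem t w.
Proof.
elim: w t => [|a w IHw] t //.
by rewrite mexp_semM mexp_semD mexp_sem0M add0r IHw.
Qed.

Lemma mexp_sem_mul u v :
  mexp_sem (MMul u v) =1 series_mul (mexp_sem u) (mexp_sem v).
Proof.
move=> w; elim: w u => [|a w IHw] u //.
by rewrite mexp_semM mexp_semD IHw mexp_sem_constM.
Qed.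

(** A leading letter shifts the argument by one, so only shorter words reach [t]; guardedness acts
    through this. *)
Lemma mexp_sem_charM a t w :
  mexp_sem (MMul (MChar a) t) w =
  if w is b :: w' then if a == b then mexp_sem t w' else 0 else 0.
Proof.
case: w => [|b w]; first by rewrite /mexp_sem /= mul0r.
rewrite mexp_sem_cons /= /char_der mexp_sem_constM.
by case: ifP; rewrite (mul1r, mul0r).
Qed.

Lemma mexp_sem_mu x g : mexp_sem (MMu x g) =1 mexp_sem (subst x (MMu x g) g).
Proof.
by case=> [|a w]; [exact: mout_mu | rewrite !mexp_sem_cons mder_mu].
Qed.

End MuSemantics.

(** * Iterated substitution of closed expressions for letters *)

Section Substitution.
Variables (K A : Type) (X : countType).
Implicit Types (r : X -> mexp K A) (S : seq X) (x y : X).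

(** Letters are coded injectively as variables in [nat]. *)
Definition mvar x : mexp K A := MVar (pickle x).

(** For closed values of [r] this sequential substitution acts as a simultaneous one. With [foldl],
    a letter appended to [S] is substituted last, as when a [mu] is unfolded after substituting
    along [S]. *)
Definition msubst r S (t : mexp K A) : mexp K A :=
  foldl (fun t x => subst (pickle x) (r x) t) t S.

Definition mgsubst r S (g : gexp K A) : gexp K A :=
  foldl (fun g x => gsubst (pickle x) (r x) g) g S.

Lemma pickle_eq x y : (pickle x == pickle y) = (x == y).
Proof. exact: (inj_eq (pcan_inj pickleK)). Qed.

Lemma subst_notin n s :
  (forall t : mexp K A, n \notin fv t -> subst n s t = t) /\
  (forall g : gexp K A, n \notin gfv g -> gsubst n s g = g).
Proof.
apply: mexp_gexp_mutind => //=.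
- by move=> m; rewrite inE eq_sym => /negPf ->.
- by move=> u IHu v IHv; rewrite mem_cat negb_or => /andP[/IHu -> /IHv ->].
- by move=> u IHu v IHv; rewrite mem_cat negb_or => /andP[/IHu -> /IHv ->].
- move=> m g IHg; rewrite mem_filter negb_and negbK eq_sym.
  by case: eqP => //= _ /IHg ->.
- by move=> a t IHt /IHt ->.
- by move=> u IHu v IHv; rewrite mem_cat negb_or => /andP[/IHu -> /IHv ->].
Qed.

Lemma msubst_closed r S (t : mexp K A) : closed t -> msubst r S t = t.
Proof.
move=> /eqP t0; elim: S => //= x S IHS.
by rewrite (proj1 (subst_notin _ _)) // t0.
Qed.

Lemma msubst_var r S x : {in S, forall y, closed (r y)} ->
  msubst r S (mvar x) = if x \in S then r x else mvar x.
Proof.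
elim: S => //= y S IHS rc; rewrite inE pickle_eq.
case: eqP => [->|_] /=; first by rewrite msubst_closed ?rc ?mem_head.
by apply: IHS => z zS; apply: rc; rewrite inE zS orbT.
Qed.

Lemma msubst_const r S k : msubst r S (MConst k) = MConst k.
Proof. by elim: S. Qed.

Lemma msubstD r S u v : msubst r S (MAdd u v) = MAdd (msubst r S u) (msubst r S v).
Proof. by elim: S u v => //= x S IHS u v; rewrite IHS. Qed.

Lemma msubstM r S u v : msubst r S (MMul u v) = MMul (msubst r S u) (msubst r S v).
Proof. by elim: S u v => //= x S IHS u v; rewrite IHS. Qed.

(** No substitution along [S] is stopped by the binder, since [pickle] is injective. *)
Lemma msubst_mu r S x g : x \notin S ->
  msubst r S (MMu (pickle x) g) = MMu (pickle x) (mgsubst r S g).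
Proof.
elim: S g => //= y S IHS g; rewrite inE negb_or => /andP[xy xS].
by rewrite pickle_eq (negPf xy) IHS.
Qed.

Lemma mgsubst_const r S k : mgsubst r S (GConst k) = GConst k.
Proof. by elim: S. Qed.

Lemma mgsubst_mul r S a t : mgsubst r S (GMul a t) = GMul a (msubst r S t).
Proof. by elim: S t => //= x S IHS t; rewrite IHS. Qed.

Lemma mgsubstD r S g h : mgsubst r S (GAdd g h) = GAdd (mgsubst r S g) (mgsubst r S h).
Proof. by elim: S g h => //= x S IHS g h; rewrite IHS. Qed.

Lemma mgsubst_rcons r S x g :
  mgsubst r (rcons S x) g = gsubst (pickle x) (r x) (mgsubst r S g).
Proof. by rewrite /mgsubst foldl_rcons. Qed.

Lemma eq_in_mgsubst r r' S g : {in S, r =1 r'} -> mgsubst r S g = mgsubst r' S g.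
Proof.
elim: S g => //= x S IHS g rr'; rewrite rr' ?mem_head // IHS // => y yS.
by rewrite rr' // inE yS orbT.
Qed.

Lemma closed_msubst r S (t : mexp K A) : {in S, forall y, closed (r y)} ->
  {subset fv t <= map pickle S} -> closed (msubst r S t).
Proof.
elim: S t => [|x S IHS] t rc tS.
  by rewrite /closed; case: (fv t) tS => // n s /(_ n (mem_head _ _)).
apply: IHS => [y yS|n]; first by rewrite rc // inE yS orbT.
rewrite (proj1 (fv_subst _ (rc x (mem_head _ _)))) mem_filter => /andP[nx nt].
by have := tS n nt; rewrite inE (negPf nx).
Qed.

End Substitution.

(** * Nested mu-expressions solving the system letter by letter *)

Section Expressions.
Variables (K : comPzSemiRingType) (A : finType) (X : finType).
Variables (o : X -> K) (delta : X -> A -> ncpoly K X).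
Implicit Types (F r : X -> mexp K A) (S : seq X) (x y : X) (n m : nat).

Definition word_exp F (u : seq X) : mexp K A :=
  foldr (fun x t => MMul (F x) t) (MConst 1) u.

Definition poly_exp F (p : ncpoly K X) : mexp K A :=
  foldr (fun u t => MAdd (MMul (MConst (nccoef p u)) (word_exp F u)) t)
    (MConst 0) (ncsupp p).

(** The right-hand side [o(x) + sum_a a * x_a], built directly as a guarded term so that it may
    stand under [mu]. *)
Definition eqn_exp F x : gexp K A :=
  foldr (fun a g => GAdd (GMul a (poly_exp F (delta x a))) g)
    (GConst (o x)) (enum A).

(** The expression [E_S(x)]. The fuel [m] makes the recursion structural; its last branch is never
    reached when [m] is at least the number of letters outside [S]. *)
Fixpoint solution m S x : mexp K A :=
  if x \in S then mvar K A x
  else if m is m'.+1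
       then MMu (pickle x) (eqn_exp (solution m' (rcons S x)) x)
       else mvar K A x.

Lemma msubst_poly_exp r S F p :
  msubst r S (poly_exp F p) = poly_exp (fun y => msubst r S (F y)) p.
Proof.
rewrite /poly_exp; elim: (enum_fset _) => [|u s IHs] /=.
  by rewrite msubst_const.
rewrite msubstD msubstM msubst_const IHs; congr (MAdd (MMul _ _) _).
by elim: u => [|x u IHu] /=; rewrite ?msubst_const // msubstM IHu.
Qed.

Lemma mgsubst_eqn_exp r S F x :
  mgsubst r S (eqn_exp F x) = eqn_exp (fun y => msubst r S (F y)) x.
Proof.
rewrite /eqn_exp; elim: (enum A) => [|a s IHs] /=.
  by rewrite mgsubst_const.
by rewrite mgsubstD mgsubst_mul msubst_poly_exp IHs.
Qed.

Lemma fv_poly_exp F p (s : seq nat) :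
  (forall y, {subset fv (F y) <= s}) -> {subset fv (poly_exp F p) <= s}.
Proof.
move=> Fs k; rewrite /poly_exp; elim: (enum_fset _) => //= u us IHus.
rewrite mem_cat => /orP[|//] {IHus}.
by elim: u => //= y u IHu; rewrite mem_cat => /orP[/Fs|].
Qed.

Lemma fv_eqn_exp F x (s : seq nat) :
  (forall y, {subset fv (F y) <= s}) -> {subset gfv (eqn_exp F x) <= s}.
Proof.
move=> Fs k; rewrite /eqn_exp; elim: (enum A) => //= a l IHl.
by rewrite mem_cat => /orP[/(fv_poly_exp Fs)|].
Qed.

Lemma card_unbound_rcons S x m : x \notin S ->
  (#|[predC S]| <= m.+1)%N -> (#|[predC rcons S x]| <= m)%N.
Proof.
move=> xS; rewrite (cardD1 x) inE xS add1n ltnS; apply: leq_trans.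
by apply/subset_leq_card/subsetP => y; rewrite !inE mem_rcons inE negb_or.
Qed.

Lemma card_unbound_gt0 S x m : x \notin S ->
  (#|[predC S]| <= m)%N -> (0 < m)%N.
Proof. by move=> xS; apply: leq_trans; apply/card_gt0P; exists x. Qed.

(** The only variable gained in passing to [rcons S x] is [x], which the [mu] binds. *)
Lemma fv_solution m S x : (#|[predC S]| <= m)%N ->
  {subset fv (solution m S x) <= map pickle S}.
Proof.
have fvS T y : y \in T -> {subset fv (mvar K A y) <= map pickle T}.
  by move=> yT k; rewrite inE => /eqP ->; apply: map_f.
elim: m S x => [|m IHm] S x Sm /=; case: ifPn => xS; first exact: fvS.
- by have := card_unbound_gt0 xS Sm.
- exact: fvS.
move=> k; rewrite mem_filter => /andP[kx].
move/(fv_eqn_exp (fun y => IHm _ y (card_unbound_rcons xS Sm))).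
by rewrite map_rcons mem_rcons inE (negPf kx).
Qed.

Local Notation letter x := (final_word o delta [:: x]).

(** Both sides are the same linear combination of Cauchy products of letters, and these operations
    preserve agreement. *)
Lemma agree_poly_exp n F (p : poly_coalgebra o delta) :
  (forall y, agree n (mexp_sem (F y)) (letter y)) ->
  agree n (mexp_sem (poly_exp F p)) (final p).
Proof.
move=> Fn w wn; rewrite final_polyE /poly_exp.
elim: (enum_fset _) => [|u s IHs] /=.
  by rewrite big_nil mexp_sem_const; case: (w).
rewrite big_cons mexp_semD IHs; congr (_ + _) => {s IHs}.
rewrite mexp_sem_constM; congr (_ * _); move: w wn.
elim: u => [|x u IHu] w wn /=; first by rewrite mexp_sem_const final_word_nil.
rewrite mexp_sem_mul final_word_cons.
exact: (series_mul_agree (Fn x) IHu).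
Qed.

(** Of the summands [b * x_b], only the one for the first letter of [w] survives. *)
Lemma mexp_sem_eqn_exp F x w :
  mexp_sem (eqn_exp F x) w =
  if w is a :: w' then mexp_sem (poly_exp F (delta x a)) w' else o x.
Proof.
have eqn_sum : mexp_sem (eqn_exp F x) w =
    \sum_a mexp_sem (MMul (MChar a) (poly_exp F (delta x a))) w
      + mexp_sem (MConst (o x) : mexp K A) w.
  rewrite /eqn_exp -big_enum /=; elim: (enum A) => [|a s IHs] /=.
    by rewrite big_nil add0r.
  by rewrite big_cons mexp_semD IHs addrA.
rewrite {}eqn_sum mexp_sem_const; case: w => [|a w].
  by rewrite big1 ?add0r // => a _; rewrite mexp_sem_charM.
rewrite (bigD1 a) //= mexp_sem_charM eqxx big1 ?addr0 // => b ba.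
by rewrite mexp_sem_charM (negPf ba).
Qed.

Lemma agree_eqn_exp n F x :
  (forall y, agree n (mexp_sem (F y)) (letter y)) ->
  agree n.+1 (mexp_sem (eqn_exp F x)) (letter x).
Proof.
move=> Fn [|a w] wn; rewrite mexp_sem_eqn_exp final_letter //.
exact: (agree_poly_exp (delta x a) Fn).
Qed.

Lemma agree_solution n m S r x : (#|[predC S]| <= m)%N ->
  {in S, forall y, closed (r y)} ->
  {in S, forall y, agree n (mexp_sem (r y)) (letter y)} ->
  agree n (mexp_sem (msubst r S (solution m S x))) (letter x).
Proof.
(* The induction hypothesis at level [n] will be used twice, for [S] itself and for [rcons S x];
   hence the generalization over [m], [S] and [r]. *)
elim: n m S r x => [|n IHn] [|m] S r x Sm rc rn //=; case: ifPn => xS;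
  try by rewrite msubst_var // xS; apply: rn.
  by have := card_unbound_gt0 xS Sm.
have tc : closed (msubst r S (solution m.+1 S x)).
  exact: closed_msubst (fv_solution Sm).
(* Unfolding the [mu] substitutes the whole expression for [x], so its own correctness one level
   lower is required. *)
have tn : agree n (mexp_sem (msubst r S (solution m.+1 S x))) (letter x).
  by apply: IHn => // y yS w wn; apply: rn => //; apply: ltnW.
move: tc tn; rewrite /= (negPf xS) msubst_mu //.
set g := eqn_exp _ x; set t := MMu _ _ => tc tn.
(* With [r] extended by [t] at [x], the unfolded body is the result of substituting along
   [rcons S x]. *)
pose r' y := if y == x then t else r y.
have rE : {in S, r =1 r'}.
  by move=> y yS; rewrite /r'; case: eqP => // yx; rewrite -yx yS in xS.
move=> w wn; rewrite mexp_sem_mu -/t -gexp_subst.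
rewrite (eq_in_mgsubst _ rE) [X in gsubst _ X _](_ : t = r' x); last first.
  by rewrite /r' eqxx.
rewrite -mgsubst_rcons mgsubst_eqn_exp.
apply: agree_eqn_exp wn => y; apply: IHn (card_unbound_rcons xS Sm) _ _ => z.
  rewrite mem_rcons inE /r'; case: eqP => // _ /= zS; exact: rc.
rewrite mem_rcons inE /r'; case: eqP => [-> _|_ /= zS] v vn; first exact: tn.
by apply: rn => //; apply: ltnW.
Qed.

Lemma closed_solution x : closed (solution #|X| [::] x).
Proof.
(* Substitution along the empty list is the identity, so it suffices that the free variables lie in
   the empty list. *)
apply: (@closed_msubst _ _ _ (fun=> MConst 0) [::]) => //.
by apply: fv_solution; apply: max_card.
Qed.

Lemma mexp_sem_solution x : mexp_sem (solution #|X| [::] x) =1 letter x.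
Proof.
(* The level is chosen per word, just above its length. *)
by move=> w; apply: (@agree_solution (size w).+1 _ [::] (fun=> MConst 0)) => //.
Qed.

End Expressions.

(** * From letters to arbitrary context-free series *)

Theorem theorem6p9 (K : comPzSemiRingType) (A : finType) (sigma : series K A) :
  context_free sigma ->
  exists t : mu_coalgebra K A, final t =1 sigma.
Proof.
move=> [X [o [delta [p pE]]]].
(* The polynomial [p] with each letter replaced by its closed solution. *)
pose t := poly_exp (solution o delta #|X| [::]) p.
have tc : closed t.
  apply: (@closed_msubst _ _ X (fun=> MConst 0) [::]) => //.
  by apply: fv_poly_exp => y; rewrite (eqP (closed_solution o delta y)).
exists (MuExp tc) => w; rewrite final_mu -pE.
apply: (@agree_poly_exp _ _ _ _ _ (size w).+1) => // y v _.
exact: mexp_sem_solution.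
Qed.
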